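(* Let $n\ge1$. For every pure product state $|\psi\rangle=|\psi_1\rangle\otimes\cdots\otimes|\psi_n\rangle$ with $|\psi_i\rangle\in\mathcal H$, one has $F_{|\psi\rangle}\le n$. Consequently, any pure state $|\psi\rangle\in\mathcal H^{\otimes n}$ with $F_{|\psi\rangle}>n$ is entangled (i.e. is not a product state of this form).
   Context: $\mathcal H$ is a complex Hilbert space (finite or infinite-dimensional), $\hat H$ is a self-adjoint operator on $\mathcal H$ with non-degenerate spectrum. On $\mathcal H^{\otimes n}$, $\hat H_i=\mathbf 1^{\otimes(i-1)}\otimes\hat H\otimes\mathbf 1^{\otimes(n-i)}$ and $\hat H_{\mathrm{coll}}=\sum_{i=1}^n\hat H_i$. Pure states are unit vectors; $\Delta_{|\psi\rangle}(\hat A)=\langle\psi|\hat A^2|\psi\rangle-\langle\psi|\hat A|\psi\rangle^2$ denotes the variance. For a pure state $|\psi\rangle\in\mathcal H^{\otimes n}$, $F_{|\psi\rangle}=\Delta_{|\psi\rangle}(\hat H_{\mathrm{coll}})/\max_{1\le i\le n}\Delta_{|\psi\rangle}(\hat H_i)$ if the denominator is nonzero, and $F_{|\psi\rangle}=0$ otherwise. If $\hat H$ is unbounded, only states lying in the domain of every $\hat H_i$ (so that all variances are finite) are considered. *)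

(* Defs.v *)
From HB Require Import structures.
From mathcomp Require Import all_boot all_order all_algebra complex.
From mathcomp Require Import all_classical all_reals all_analysis.

Set Implicit Arguments.
Unset Strict Implicit.
Unset Printing Implicit Defensive.

Import Order.TTheory GRing.Theory Num.Theory Num.Def.
Import numFieldNormedType.Exports.

Local Open Scope classical_set_scope.
Local Open Scope complex_scope.
Local Open Scope ring_scope.

(* The norm of a complex Hilbert space takes its values in R[i] and is real
   and nonnegative there; completeness refers to this norm. *)
HB.mixin Record CompleteNormedModule_isHilbert (R : realType) V
    of CompleteNormedModule R[i] V := {
  dotprod : {dot V for (@conjC R[i])} ;
  sqr_norm_dotprod : forall x : V, `|x| ^+ 2 = dotprod x x }.

#[short(type="hilbertType")]
HB.structure Definition Hilbert (R : realType) :=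
  {V of CompleteNormedModule R[i] V & CompleteNormedModule_isHilbert R V}.

(* {dot V for conjC} is linear on the left and antilinear on the right,
   whereas <x|y> is antilinear in x and linear in y. *)
Definition braket (R : realType) (V : hilbertType R) (x y : V) : R[i] :=
  dotprod y x.

Notation "''<' x | y '>'" := (braket x y)
  (at level 0, x at level 69, y at level 69,
   format "''<' x  |  y '>'") : ring_scope.

Definition pure_state (R : realType) (V : hilbertType R) (psi : V) : Prop :=
  `|psi| = 1.

(* Possibly unbounded operators: the values of [act] outside [dom] are junk. *)
Record operator (R : realType) (V : hilbertType R) := Operator {
  dom : set V ;
  act :> V -> V }.

Section Operators.
Variables (R : realType) (V : hilbertType R).
Implicit Types (A : operator V) (psi : V).

Definition is_linear A : Prop :=
  dom A 0 /\
  forall (a : R[i]) (x y : V), dom A x -> dom A y ->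
    dom A (a *: x + y) /\ A (a *: x + y) = a *: A x + A y.

Definition graph A : set (V * V) := [set p | dom A p.1 /\ p.2 = A p.1].

Definition adjoint_graph A : set (V * V) :=
  [set p | forall y, dom A y -> '<p.1 | A y> = '<p.2 | y> ].

(* Equality of graphs says that A^* and A have the same domain. *)
Definition self_adjoint A : Prop :=
  [/\ is_linear A, dense (dom A) & adjoint_graph A = graph A].

(* Every eigenvalue has a one-dimensional eigenspace. This is the usual meaning
   when the spectrum consists of eigenvalues, and a multiplicity-free operator
   with continuous spectrum satisfies it as well. *)
Definition nondegenerate_spectrum A : Prop :=
  forall (a : R[i]) (x y : V),
    dom A x -> A x = a *: x -> x != 0 ->
    dom A y -> A y = a *: y -> exists c : R[i], y = c *: x.

(* For self-adjoint A, <psi|A^2|psi> is understood as the quadratic form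
   <A psi|A psi>, which makes sense on the whole of dom A; see
   [qvarianceE] for psi in the domain of A^2. Both terms are real. *)
Definition qvariance A psi : R :=
  complex.Re ('<A psi | A psi> - '<psi | A psi> ^+ 2).

Lemma qvarianceE A psi : self_adjoint A -> dom A psi -> dom A (A psi) ->
  qvariance A psi = complex.Re ('<psi | A (A psi)> - '<psi | A psi> ^+ 2).
Proof.
move=> [_ _ AA] dpsi dApsi; rewrite /qvariance.
suff -> : '<psi | A (A psi)> = '<A psi | A psi> by [].
have : adjoint_graph A (psi, A psi) by rewrite AA.
exact.
Qed.

(* Meaningful when G is the graph of an operator. *)
Definition operator_of_graph (G : set (V * V)) : operator V :=
  {| dom := [set x | exists y, G (x, y)] ;
     act x := xget 0 [set y | G (x, y)] |}.

(* The sum, on the common domain. *)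
Definition sum_operator n (A : 'I_n -> operator V) : operator V :=
  {| dom := [set x | forall i, dom (A i) x] ;
     act x := \sum_(i < n) A i x |}.

End Operators.

(* The n-th Hilbert space tensor power of H, given by its characterization:
   a Hilbert space K and a multilinear map (x_i)_i |-> x_1 (x) ... (x) x_n with
   <(x)_i x_i | (x)_i y_i> = \prod_i <x_i | y_i>, whose image spans a dense
   subspace. This determines (K, tens) up to a unique compatible unitary. *)
Record tensor_power (R : realType) (H K : hilbertType R) (n : nat) :=
  TensorPower {
    tens :> ('I_n -> H) -> K ;
    tens_linear : forall (x : 'I_n -> H) (i : 'I_n) (a : R[i]) (u v : H),
      tens [eta x with i |-> a *: u + v] =
      a *: tens [eta x with i |-> u] + tens [eta x with i |-> v] ;
    tens_braket : forall x y : 'I_n -> H,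
      '<tens x | tens y> = \prod_(i < n) '<x i | y i> ;
    tens_dense : dense [set z | exists m (c : 'I_m -> R[i])
      (x : 'I_m -> 'I_n -> H), z = \sum_(k < m) c k *: tens (x k)] }.

Section Collective.
Variables (R : realType) (H K : hilbertType R) (n : nat).
Variables (T : tensor_power H K n) (A : operator H).

(* Graph of 1 (x) ... (x) A (x) ... (x) 1 on the algebraic tensor product
   H (x) ... (x) dom A (x) ... (x) H. *)
Definition algebraic_site_graph (i : 'I_n) : set (K * K) :=
  [set p | exists m (x : 'I_m -> 'I_n -> H),
    [/\ forall k, dom A (x k i),
        p.1 = \sum_(k < m) T (x k) &
        p.2 = \sum_(k < m) T [eta x k with i |-> A (x k i)]]].

(* For self-adjoint A the algebraic operator is essentially self-adjoint, and
   A_i is its closure. *)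
Definition site_operator (i : 'I_n) : operator K :=
  operator_of_graph (closure (algebraic_site_graph i)).

Definition collective_operator : operator K := sum_operator site_operator.

(* Variances are nonnegative on pure states, so that starting the maximum at 0
   is harmless when 0 < n. *)
Definition max_variance (psi : K) : R :=
  \big[Num.max/0]_(i < n) qvariance (site_operator i) psi.

Definition Fratio (psi : K) : R :=
  if max_variance psi == 0 then 0
  else qvariance collective_operator psi / max_variance psi.

Definition in_site_domains (psi : K) : Prop :=
  forall i, dom (site_operator i) psi.

Definition product_vector (psi : K) : Prop :=
  exists x : 'I_n -> H, psi = T x.

Definition entangled (psi : K) : Prop := ~ product_vector psi.

End Collective.

(* Main.v *)
Require Import Defs.
From mathcomp Require Import all_boot all_order all_algebra complex.
From mathcomp Require Import all_classical all_reals all_analysis.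
From mathcomp Require Import ring.

(** For a product vector T x lying in the domain of every A_i, the vector
A_i (T x) differs from T x only in the i-th factor: the partial inner product
of A_i (T x) with the other factors of T x exists because H is complete, and
the symmetry of the closed operator A_i together with the density of dom A
determines A_i (T x) from it. Hence the covariances of A_i and A_j in a product
state vanish for i <> j, the variance of the collective operator is the sum of
the n local variances, and this sum is at most n times their maximum. *)

Set Implicit Arguments.
Unset Strict Implicit.
Unset Printing Implicit Defensive.

Import Order.TTheory GRing.Theory Num.Theory Num.Def.
Import numFieldNormedType.Exports.

Local Open Scope classical_set_scope.
Local Open Scope complex_scope.
Local Open Scope ring_scope.

Lemma dense_closedT (W : topologicalType) (S D : set W) :
  dense S -> closed D -> S `<=` D -> forall w, D w.
Proof.
move=> dS cD SD w; apply: contrapT => nDw.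
have [|v [nDv /SD]] // := dS (~` D) _ (closed_openC cD).
by exists w.
Qed.

(** * Inner products: Cauchy-Schwarz, continuity, density arguments *)

Section Braket.
Variables (R : realType) (V : hilbertType R).
Implicit Types (x y z : V) (a : R[i]).

Lemma braketC x y : '<x | y> = ('<y | x>)^*.
Proof. by rewrite /braket hermC mul1r. Qed.

Lemma braketDr x y z : '<x | y + z> = '<x | y> + '<x | z>.
Proof. by rewrite /braket linearDl. Qed.

Lemma braketZr a x y : '<x | a *: y> = a * '<x | y>.
Proof. by rewrite /braket linearZl_LR. Qed.

Lemma braketNr x y : '<x | - y> = - '<x | y>.
Proof. by rewrite -scaleN1r braketZr mulN1r. Qed.

Lemma braketBr x y z : '<x | y - z> = '<x | y> - '<x | z>.
Proof. by rewrite braketDr braketNr. Qed.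

Lemma braket0r x : '<x | 0> = 0.
Proof. by rewrite -(scale0r 0) braketZr mul0r. Qed.

Lemma braketBl x y z : '<y - z | x> = '<y | x> - '<z | x>.
Proof. by rewrite braketC braketBr rmorphB /= -!braketC. Qed.

Lemma braketZl a x y : '<a *: y | x> = a^* * '<y | x>.
Proof. by rewrite braketC braketZr rmorphM /= -!braketC. Qed.

Lemma braket0l x : '<0 | x> = 0.
Proof. by rewrite braketC braket0r rmorph0. Qed.

Lemma braket_sumr (I : Type) (r : seq I) (P : pred I) (F : I -> V) x :
  '<x | \sum_(i <- r | P i) F i> = \sum_(i <- r | P i) '<x | F i>.
Proof. exact: (big_morph _ (braketDr x) (braket0r x)). Qed.

Lemma braket_suml (I : Type) (r : seq I) (P : pred I) (F : I -> V) x :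
  '<\sum_(i <- r | P i) F i | x> = \sum_(i <- r | P i) '<F i | x>.
Proof.
by rewrite braketC braket_sumr rmorph_sum; apply: eq_bigr => i _; rewrite [RHS]braketC.
Qed.

Lemma braketxx x : '<x | x> = `|x| ^+ 2.
Proof. by rewrite /braket sqr_norm_dotprod. Qed.

Lemma braket_CauchySchwarz x y : `|'<x | y>| <= `|x| * `|y|.
Proof.
have [->|x0] := eqVneq x 0; first by rewrite braket0l !normr0 mul0r.
have b0 : 0 < `|x| ^+ 2 by rewrite exprn_gt0 ?normr_gt0.
have b0' : 0 <= `|x| ^+ 2 by exact: ltW.
rewrite -(@ler_pXn2r _ 2)// ?nnegrE ?mulr_ge0// exprMn.
set c := '<x | y>.
(* Up to the factor [|x| ^+ 2], this is the component of [y] orthogonal to [x]; its square norm is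
   |x|^2 (|x|^2 |y|^2 - |c|^2). *)
pose w := `|x| ^+ 2 *: y - c *: x.
have xw : '<x | w> = 0.
  by rewrite braketBr !braketZr braketxx -/c mulrC subrr.
have : 0 <= '<w | w> by rewrite braketxx exprn_ge0.
rewrite {2}/w braketBr !braketZr (braketC _ x) xw rmorph0 mulr0 subr0.
rewrite pmulr_rge0// /w braketBl !braketZl -/c braketxx.
by rewrite (CrealP (ger0_real b0')) subr_ge0 normCK mulrC.
Qed.

Lemma braket_continuous x : continuous (fun y => '<x | y> : R[i]^o).
Proof.
move=> y; apply/cvgrPdist_lt => e e0.
have d0 : 0 < e / (`|x| + 1) by rewrite divr_gt0// ltr_wpDl.
near=> z; rewrite -[X in `|X|]/('<x | y> - '<x | z>) -braketBr.
rewrite (le_lt_trans (braket_CauchySchwarz _ _))//.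
apply: (@le_lt_trans _ _ ((`|x| + 1) * `|y - z|)).
  by rewrite ler_wpM2r// lerDl.
by rewrite mulrC -ltr_pdivlMr ?ltr_wpDl.
Unshelve. all: by end_near. Qed.

Lemma braket_inj x y : (forall z, '<z | x> = '<z | y>) -> x = y.
Proof.
move=> xy; apply/subr0_eq/normr0_eq0/eqP.
by rewrite -sqrf_eq0 -braketxx braketBr xy subrr.
Qed.

Lemma braket_dense_inj (S : set V) x y : dense S ->
  (forall z, S z -> '<z | x> = '<z | y>) -> x = y.
Proof.
move=> dS Sxy; apply/subr0_eq/braket_inj => z; rewrite braket0r braketC.
pose D := [set z | '<x - y | z> = 0].
have -> : '<x - y | z> = 0; last by rewrite rmorph0.
apply: (@dense_closedT _ _ D dS) => [|v Sv].
  apply: (@preimage_closed _ R[i]^o (fun z => '<x - y | z>) [set 0]) => [? _|]; first exact: braket_continuous.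
  exact: (accessible_closed_set1 (hausdorff_accessible (@norm_hausdorff _ R[i]^o))).
by rewrite /D /= braketC braketBr Sxy// subrr rmorph0.
Qed.

(** Serves to carry the symmetry relation of an operator from its graph to the closure of that
    graph. *)
Lemma closed_braket_eq (x y : V) :
  closed [set p : V * V | '<x | p.1> = '<y | p.2> ].
Proof.
have -> : [set p : V * V | '<x | p.1> = '<y | p.2> ] =
    (fun p => '<x | p.1> - '<y | p.2> : R[i]^o) @^-1` [set 0].
  apply/seteqP; split=> p /=; first by move=> ->; rewrite subrr.
  exact: subr0_eq.
apply: preimage_closed => [p _|].
  apply: (@cvgB _ R[i]^o).
    by apply: continuous_comp; [exact: cvg_fst|exact: braket_continuous].
  by apply: continuous_comp; [exact: cvg_snd|exact: braket_continuous].
exact: (accessible_closed_set1 (hausdorff_accessible (@norm_hausdorff _ R[i]^o))).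
Qed.

End Braket.

(** * Adjoints of bounded maps *)

Section Adjoint.
Variables (R : realType) (V W : hilbertType R) (f : V -> W) (s : R[i]).
Hypotheses (s_ge0 : 0 <= s) (f_bounded : forall u, `|f u| <= s * `|u|).

Let adjoint_at (a : W) (h : V) := forall u, '<f u | a> = '<u | h>.

(** Testing against [u := h] gives |h|^2 = <f h|a>, which Cauchy-Schwarz bounds by s |h| |a|; then
    divide by |h|. *)
Lemma adjoint_at_norm a h : adjoint_at a h -> `|h| <= s * `|a|.
Proof.
move=> ah; have [->|h0] := eqVneq h 0; first by rewrite normr0 mulr_ge0.
rewrite -(@ler_pM2l _ `|h|) ?normr_gt0// -expr2 -braketxx -ah.
have : 0 <= '<f h | a> by rewrite ah braketxx exprn_ge0.
move=> /ger0_norm <-; apply: (le_trans (braket_CauchySchwarz _ _)).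
by rewrite mulrA ler_wpM2r// mulrC.
Qed.

(* The partial adjoint is Lipschitz by [adjoint_at_norm], so its values along a
   net converging to a limit point of its domain form a Cauchy net. *)
Lemma bounded_adjoint_closed :
  closed [set a | exists h, forall u, '<f u | a> = '<u | h> ].
Proof.
set D := [set a | _] => a Da.
pose g b := xget 0 (adjoint_at b).
have gP b : D b -> adjoint_at b (g b).
  by move=> Db; have := xgetPex 0 Db.
pose F := within D (nbhs a).
have FF : ProperFilter F by exact: within_nbhs_proper.
have gF : cvg (g @ F).
  apply/cauchy_cvgP; apply: cauchy_exP => e e0.
  (* Two points this close to [a] are less than [e / (s + 1)] apart, so their images under [g] are
     less than [e] apart; [s + 1] replaces [s], which may be 0. *)
  have d0 : 0 < e / (s + 1) / 2 by rewrite !divr_gt0// ltr_wpDl.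
  have FD : \forall b \near F, D b /\ `|a - b| < e / (s + 1) / 2.
    apply: filterI; first exact: withinT.
    apply: cvg_within; apply/nbhs_ballP; exists (e / (s + 1) / 2) => // b.
    by rewrite -ball_normE.
  have [b0 [Db0 ab0]] := filter_ex FD.
  exists (g b0); apply: filterS FD => b [Db ab] /=.
  rewrite -ball_normE /ball_ /=.
  have /adjoint_at_norm : adjoint_at (b0 - b) (g b0 - g b).
    by move=> u; rewrite !braketBr !gP.
  move=> /le_lt_trans; apply.
  apply: (@le_lt_trans _ _ ((s + 1) * `|b0 - b|)).
    by rewrite ler_wpM2r// lerDl.
  rewrite mulrC -ltr_pdivlMr; last by rewrite ltr_wpDl.
  rewrite [ltRHS]splitr (le_lt_trans (ler_distD a _ _))// ltrD//.
  by rewrite distrC.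
exists (lim (g @ F)) => u.
have fu : (fun b => '<f u | b> : R[i]^o) @ F --> ('<f u | a> : R[i]^o).
  exact: (cvg_within_filter D (@braket_continuous _ _ (f u) a)).
apply: (cvg_unique (@norm_hausdorff _ R[i]^o) fu).
have gu : (fun b => '<u | g b> : R[i]^o) @ F --> ('<u | (lim (g @ F))> : R[i]^o).
  exact: (cvg_comp _ _ gF (@braket_continuous _ _ u (lim (g @ F)))).
apply: cvg_trans gu; apply: near_eq_cvg.
by apply: filterS (withinT _ _) => b Db; rewrite gP.
Qed.

End Adjoint.

(** * Tensor products and partial contractions *)

Section Tensor.
Variables (R : realType) (H K : hilbertType R) (n : nat).
Variable T : tensor_power H K n.
Implicit Types (x y : 'I_n -> H) (i j : 'I_n) (u v w : H).

Lemma fun_with_id x i : [eta x with i |-> x i] = x :> ('I_n -> H).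
Proof. by apply/funext => j /=; case: eqVneq => [->|]. Qed.

Lemma fun_with_with x i u v :
  [eta [eta x with i |-> u] with i |-> v] = [eta x with i |-> v] :> ('I_n -> H).
Proof. by apply/funext => j /=; case: eqVneq. Qed.

Lemma tens_braket_with x y i u v :
  '<T [eta x with i |-> u] | T [eta y with i |-> v]> =
  '<u | v> * \prod_(j < n | j != i) '<x j | y j>.
Proof.
rewrite tens_braket (bigD1 i)//= eqxx; congr *%R.
by apply: eq_bigr => j /negbTE ->.
Qed.

Lemma tens_braket_withl x y i u :
  '<T [eta x with i |-> u] | T y> =
  '<u | y i> * \prod_(j < n | j != i) '<x j | y j>.
Proof. by rewrite -{1}(fun_with_id y i) tens_braket_with. Qed.

Lemma norm_tens_with x i u :
  `|T [eta x with i |-> u]| = (\prod_(j < n | j != i) `|x j|) * `|u|.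
Proof.
apply/eqP; rewrite -(@eqrXn2 _ 2)// ?mulr_ge0 ?prodr_ge0//.
rewrite -braketxx tens_braket_with braketxx exprMn mulrC -prodrXl.
by rewrite (eq_bigr _ (fun j _ => braketxx (x j))).
Qed.

(** For a finite combination of product vectors the contraction is an explicit sum. The vectors [a]
    that admit one form a closed set, because inserting [u] in slot [i] is bounded, and density of
    the combinations does the rest. *)
Lemma partial_contraction x i (a : K) :
  exists w, forall u, '<T [eta x with i |-> u] | a> = '<u | w>.
Proof.
apply: (dense_closedT (tens_dense T)
  (bounded_adjoint_closed (f := fun u => T [eta x with i |-> u])
    (s := \prod_(j < n | j != i) `|x j|) _ _)) => [|u|].
- by rewrite prodr_ge0.
- by rewrite norm_tens_with.
move=> _ [m [c [y ->]]].
exists (\sum_(k < m) (c k * \prod_(j < n | j != i) '<x j | y k j>) *: y k i) => u.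
rewrite !braket_sumr; apply: eq_bigr => k _.
by rewrite !braketZr tens_braket_withl mulrCA mulrC.
Qed.

(** * Site operators: symmetry and action on product vectors *)

Variable A : operator H.
Hypotheses (dA : dense (dom A)).
Hypothesis symA : forall u v, dom A u -> dom A v -> '<u | A v> = '<A u | v>.

Lemma algebraic_site_symmetric i (p q : K * K) :
  algebraic_site_graph T A i p -> algebraic_site_graph T A i q ->
  '<p.1 | q.2> = '<p.2 | q.1>.
Proof.
move=> [m [x [dx -> ->]]] [l [y [dy -> ->]]].
rewrite !braket_suml; apply: eq_bigr => k _.
rewrite !braket_sumr; apply: eq_bigr => h _.
rewrite tens_braket_withl -symA//.
by rewrite -{1}(fun_with_id (x k) i) tens_braket_with.
Qed.

(** With one of the two pairs fixed, the relation is closed in the other, so it passes to the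
    closure one argument at a time. *)
Lemma closure_site_symmetric i (p q : K * K) :
  closure (algebraic_site_graph T A i) p ->
  closure (algebraic_site_graph T A i) q ->
  '<p.1 | q.2> = '<p.2 | q.1>.
Proof.
have half p' q' : algebraic_site_graph T A i p' ->
    closure (algebraic_site_graph T A i) q' -> '<p'.1 | q'.2> = '<p'.2 | q'.1>.
  move=> Gp'; rewrite closureE => /(_ [set z | '<p'.2 | z.1> = '<p'.1 | z.2> ]).
  move=> /(_ _)/esym; apply; split; first exact: closed_braket_eq.
  by move=> z Gz; rewrite /= (algebraic_site_symmetric Gp' Gz).
move=> Gp Gq; move: Gp; rewrite closureE.
move=> /(_ [set z | '<q.2 | z.1> = '<q.1 | z.2> ]) Gp.
rewrite braketC [RHS]braketC; congr conjC.
apply: Gp; split; first exact: closed_braket_eq.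
by move=> z Gz; rewrite /= braketC half// -braketC.
Qed.

(* z is a multiple of the partial contraction of phi against x; the equality is
   tested against the vectors T y with y i in dom A, on which A_i is explicit. *)
Lemma closure_site_product i x (phi : K) : T x != 0 ->
  closure (algebraic_site_graph T A i) (T x, phi) ->
  exists z, phi = T [eta x with i |-> z].
Proof.
move=> Tx0 Gphi.
have sym y u : dom A u ->
    '<T [eta y with i |-> u] | phi> = '<T [eta y with i |-> A u] | T x>.
  move=> du; apply: (@closure_site_symmetric i (_, _) (T x, phi)) => //.
  apply: subset_closure; exists 1%N, (fun=> [eta y with i |-> u]).
  rewrite !big_ord1 fun_with_with /= eqxx.
  by split=> // k.
pose p := \prod_(j < n | j != i) '<x j | x j>.
(* The square norm of [T x] is <x i|x i> times [p]. *)
have p0 : p != 0.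
  apply: contra Tx0 => /eqP p0; rewrite -normr_eq0 -sqrf_eq0 -braketxx.
  by rewrite -{1}(fun_with_id x i) tens_braket_withl -/p p0 mulr0.
have [w xw] := partial_contraction x i phi.
exists (p^-1 *: w).
suff Tphi y : '<T y | phi> = '<T y | T [eta x with i |-> p^-1 *: w]>.
  apply: (braket_dense_inj (tens_dense T)) => _ [m [c [y ->]]].
  by rewrite !braket_suml; apply: eq_bigr => k _; rewrite !braketZl Tphi.
have [h yh] := partial_contraction y i phi.
rewrite -{1 2}(fun_with_id y i) yh tens_braket_with.
pose q := \prod_(j < n | j != i) '<y j | x j>; rewrite -/q.
suff -> : h = q *: (p^-1 *: w) by rewrite braketZr mulrC.
(* By [sym], for [u] in the domain of [A], <u|h> is [q] times <A u|x i> and <u|w> is [p] times the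
   same number. *)
apply: (braket_dense_inj dA) => u du.
rewrite -yh sym// tens_braket_withl -/q !braketZr -xw sym//.
by rewrite tens_braket_withl -/p mulrC (mulrC _ p) mulKf.
Qed.

End Tensor.

(** * Variances in product states *)

Lemma qvariance_sum (R : realType) (V : hilbertType R) (n : nat)
    (B : 'I_n -> operator V) (psi : V) :
  (forall i, '<B i psi | psi> = '<psi | B i psi>) ->
  (forall i j, i != j ->
    '<B i psi | B j psi> = '<B i psi | psi> * '<psi | B j psi>) ->
  qvariance (sum_operator B) psi = \sum_(i < n) qvariance (B i) psi.
Proof.
move=> realB covB; rewrite /qvariance /= braket_suml braket_sumr expr2 mulr_suml.
rewrite -sumrB raddf_sum; apply: eq_bigr => i _ /=; congr complex.Re.
(* Both terms are now double sums; in row [i] of their difference the entries with j != i are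
   covariances and vanish. *)
rewrite braket_sumr mulr_sumr -sumrB (bigD1 i)//= big1 ?addr0 ?expr2// => j ji.
by rewrite covB 1?eq_sym// realB subrr.
Qed.

Section ProductState.
Variables (R : realType) (H K : hilbertType R) (n : nat).
Variables (T : tensor_power H K n) (A : operator H).
Hypothesis saA : self_adjoint A.

Lemma self_adjoint_dense : dense (dom A).
Proof. by case: saA. Qed.

Lemma self_adjoint_symmetric u v : dom A u -> dom A v -> '<u | A v> = '<A u | v>.
Proof.
case: saA => _ _ AA du; have : adjoint_graph A (u, A u) by rewrite AA.
exact.
Qed.

Lemma site_operator_closure i psi : dom (site_operator T A i) psi ->
  closure (algebraic_site_graph T A i) (psi, site_operator T A i psi).
Proof. exact: xgetPex. Qed.

(** All these inner products share the factor [p] from the slots other than [i] and [j]. Multiplying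
    the left side by <T x|T x> = 1 makes the two sides the same product of slot factors. *)
Lemma site_covariance (x z : 'I_n -> H) i j : i != j ->
  '<T x | T x> = 1 ->
  '<T [eta x with i |-> z i] | T [eta x with j |-> z j]> =
  '<T [eta x with i |-> z i] | T x> * '<T x | T [eta x with j |-> z j]>.
Proof.
move=> ij x1; pose p := \prod_(k < n | (k != i) && (k != j)) '<x k | x k>.
have split2 y w : (forall k, k != i -> k != j -> '<y k | w k> = '<x k | x k>) ->
    '<T y | T w> = '<y i | w i> * ('<y j | w j> * p).
  move=> yw; rewrite tens_braket (bigD1 i)// (bigD1 j) 1?eq_sym//.
  by congr (_ * (_ * _)); apply: eq_bigr => k /andP[]; exact: yw.
rewrite -[LHS]mulr1 -x1 !split2 /= ?eqxx ?(negbTE ij) 1?eq_sym ?(negbTE ij).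
  by ring.
all: by move=> // k /negbTE ki /negbTE kj; rewrite ?ki ?kj.
Qed.

Lemma qvariance_collective_product (psi : K) :
  pure_state psi -> product_vector T psi -> in_site_domains T A psi ->
  qvariance (collective_operator T A) psi =
  \sum_(i < n) qvariance (site_operator T A i) psi.
Proof.
move=> psi1 [x psiE] dpsi.
have G i := site_operator_closure (dpsi i).
have xx : '<T x | T x> = 1 by rewrite -psiE braketxx psi1 expr1n.
have Tx0 : T x != 0 by rewrite -normr_eq0 -psiE psi1 oner_eq0.
have /choice[z zE] i : exists z,
    site_operator T A i psi = T [eta x with i |-> z].
  apply: (closure_site_product self_adjoint_dense self_adjoint_symmetric Tx0).
  by rewrite -psiE.
apply: qvariance_sum => [i|i j ij].
  (* Symmetry applied to a pair of the closed graph and itself: the expectation value is real. *)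
  by have := closure_site_symmetric self_adjoint_symmetric (G i) (G i).
by rewrite !zE psiE site_covariance.
Qed.

End ProductState.

Lemma qvariance_sum_le (R : realType) (H K : hilbertType R) (n : nat)
    (T : tensor_power H K n) (A : operator H) (psi : K) :
  \sum_(i < n) qvariance (site_operator T A i) psi <=
  n%:R * max_variance T A psi.
Proof.
have -> : n%:R * max_variance T A psi = \sum_(i < n) max_variance T A psi.
  by rewrite sumr_const card_ord mulr_natl.
by apply: ler_sum => i _; exact: le_bigmax.
Qed.

Theorem mainTheorem5 (R : realType) (H K : hilbertType R) (n : nat)
    (hn : (1 <= n)%N) (T : tensor_power H K n) (A : operator H)
    (hA : self_adjoint A) (hA' : nondegenerate_spectrum A) :
  (forall psi : K, pure_state psi -> product_vector T psi ->
     in_site_domains T A psi -> Fratio T A psi <= n%:R) /\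
  (forall psi : K, pure_state psi -> in_site_domains T A psi ->
     n%:R < Fratio T A psi -> entangled T psi).
Proof.
have bound psi : pure_state psi -> product_vector T psi ->
    in_site_domains T A psi -> Fratio T A psi <= n%:R.
  move=> psi1 psiT dpsi; rewrite /Fratio; case: eqVneq => [//|max0].
  (* The maximum starts at 0, so being nonzero it is positive. *)
  rewrite ler_pdivrMr; last by rewrite lt_def max0; exact: bigmax_ge_id.
  by rewrite qvariance_collective_product//; exact: qvariance_sum_le.
split=> // psi psi1 dpsi nF psiT.
by have := bound psi psi1 psiT dpsi; rewrite leNgt nF.
Qed.
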